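(* Let $\mathbb{H}$ be a complex Hilbert space and let $A,B\in\mathbb{B}(\mathbb{H})$. Then $$\omega_e^2(A,B)\le\sqrt{\left\|\omega^2(A)|A^*|^2+\omega^2(B)|B^*|^2\right\|+2\,\omega(A)\,\omega(B)\,\omega(AB^* )}.$$
   Context: $\mathbb{B}(\mathbb{H})$ is the algebra of bounded linear operators on $\mathbb{H}$, $\|\cdot\|$ is the operator norm, $|T|=(T^*T)^{1/2}$ (so $|T^*|^2=TT^*$), and $\omega(T)=\sup_{\|x\|=1}|\langle Tx,x\rangle|$ is the numerical radius. The Euclidean operator radius of a pair is $\omega_e(A,B)=\sup_{\|x\|=1}\left(|\langle Ax,x\rangle|^2+|\langle Bx,x\rangle|^2\right)^{1/2}$. Powers such as $\omega^2(A)$ mean $(\omega(A))^2$, and $\omega_e^2(A,B)=(\omega_e(A,B))^2$. *)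

(* Defs.v *)
From HB Require Import structures.
From mathcomp Require Import all_boot all_order all_algebra sesquilinear.
From mathcomp Require Import all_classical all_reals all_analysis.
From mathcomp Require Export complex.

Set Implicit Arguments.
Unset Strict Implicit.
Unset Printing Implicit Defensive.

Import Order.TTheory GRing.Theory Num.Theory.
Import numFieldNormedType.Exports.

Local Open Scope classical_set_scope.
Local Open Scope ring_scope.
Local Open Scope complex_scope.

(* The inner product is linear in its first argument and conjugate-linear in
   its second one. *)
HB.mixin Record CompleteNormedModule_isHilbert (R : realType) (H : Type)
    of CompleteNormedModule R[i] H := {
  dotp : {dot H for (@conjc R)};
  dotp_norm : forall x : H, dotp x x = `|x| ^+ 2
}.

#[short(type="hilbertType")]
HB.structure Definition Hilbert (R : realType) :=
  { H of CompleteNormedModule R[i] H & CompleteNormedModule_isHilbert R H }.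

Section HilbertOperators.
Context {R : realType} {H : hilbertType R}.

(* The library norm of a normed module over [R[i]] takes its (real,
   nonnegative) values in [R[i]]; [hnorm] is the same norm valued in [R]. *)
Definition hnorm (x : H) : R := complex.Re `|x|.

Record bounded_op := BoundedOp {
  bop_fun :> {linear H -> H};
  bop_bounded : exists M : R, forall x, hnorm (bop_fun x) <= M * hnorm x
}.

HB.instance Definition _ := gen_eqMixin bounded_op.
HB.instance Definition _ := gen_choiceMixin bounded_op.

Definition is_adjoint (T S : bounded_op) : Prop :=
  forall x y : H, dotp (T x) y = dotp x (S y).

(* The adjoint of [T] exists (Riesz) and is unique, so that the default value
   [T] of [xget] is never used. *)
Definition adjoint (T : bounded_op) : bounded_op :=
  xget T [set S | is_adjoint T S].

(* In [R[i]], [0 <= z] means that [z] is real and nonnegative. *)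
Definition positive_op (P : bounded_op) : Prop :=
  forall x : H, 0 <= dotp (P x) x.

Definition is_modulus (T P : bounded_op) : Prop :=
  positive_op P /\ forall x : H, P (P x) = adjoint T (T x).

(* The modulus (T^* T)^(1/2): the unique positive square root of T^* T; again
   the default value [T] is never used. *)
Definition modulus (T : bounded_op) : bounded_op :=
  xget T [set P | is_modulus T P].

(* The quantities below are finite suprema when the functions are bounded
   linear operators. If H = {0}, then the unit sphere is empty and its image
   has supremum 0, by the library convention [sup set0 = 0]. *)
Definition opnorm (T : H -> H) : R :=
  sup [set hnorm (T x) | x in [set x | hnorm x <= 1]].

Definition numerical_radius (T : H -> H) : R :=
  sup [set Normc.normc (dotp (T x) x) | x in [set x | hnorm x = 1]].

Definition euclidean_radius (S T : H -> H) : R :=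
  sup [set Num.sqrt (Normc.normc (dotp (S x) x) ^+ 2
                     + Normc.normc (dotp (T x) x) ^+ 2)
      | x in [set x | hnorm x = 1]].

End HilbertOperators.

Arguments bounded_op {R} H.

(* Main.v *)
From HB Require Import structures.
Require Import Defs.
From mathcomp Require Import all_boot all_order all_algebra.
From mathcomp Require Import sesquilinear ring lra.
From mathcomp Require Import all_classical all_reals all_analysis.

(** The inequality itself is a short computation.  Let [x] be a unit vector,
    [p = <Ax,x>] and [q = <Bx,x>].  With [w = p A^*x + q B^*x] one has
    [|p|^2 + |q|^2 = <x,w>], hence [|p|^2 + |q|^2 <= ||w||], and

      [||w||^2 = |p|^2 ||A^*x||^2 + |q|^2 ||B^*x||^2
                 + 2 Re (p q^* <A^*x,B^*x>)].

    In the first two terms [|p|] and [|q|] are at most the numerical radii, and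
    [||A^*x||^2 = <|A^*|^2 x,x>], so that together they are bounded by the
    quadratic form of [w(A)^2 |A^*|^2 + w(B)^2 |B^*|^2] at [x], hence by its
    norm.  In the last term [|<A^*x,B^*x>| = |<AB^*x,x>|] is at most the
    numerical radius of [AB^*].  Taking the supremum over [x] concludes.

    The computation uses the defining properties of the adjoint and of the
    modulus, so the work is in showing that these operators exist.

    The adjoint comes from the Riesz representation theorem ([riesz]), proved
    by minimising [||x||^2 - 2 Re f(x)]: the parallelogram law makes minimising
    sequences Cauchy, and the first variation at the minimum says that it
    represents [f].

    The modulus is a square root of [T^*T] ([sqrt_of_contraction]).  After a
    scaling, [C = 1 - T^*T] is a contraction, and [1 - V] is a square root of
    [1 - C] when [V = (C + V^2) / 2].  This fixed point is the limit of the
    iteration [Y_{n+1} = (C + Y_n^2) / 2], [Y_0 = 0], whose increments are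
    dominated by those of the scalar iteration obtained for [C = 1], which
    increases to [1].

    All the limits involved are reached at speed [O(1/n)]; [fast_cvg] records
    this, and reduces each passage to the limit to the Archimedean property
    ([le0_of_rate]). *)

Set Implicit Arguments.
Unset Strict Implicit.
Unset Printing Implicit Defensive.

Import Order.TTheory GRing.Theory Num.Theory.
Import numFieldNormedType.Exports.

Local Open Scope ring_scope.
Local Open Scope complex_scope.

Local Notation Re := complex.Re.
Local Notation normc := Normc.normc.

(** * Inner product and norm *)

Section InnerProduct.
Context {R : realType} {H : hilbertType R}.
Implicit Types (x y z : H) (a b : R[i]) (r : R).

Lemma dotp0l x : dotp 0 x = 0.
Proof. exact: linear0l. Qed.
Lemma dotp0r x : dotp x 0 = 0.
Proof. exact: linear0r. Qed.
Lemma dotpDl x y z : dotp (x + y) z = dotp x z + dotp y z.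
Proof. exact: linearDl. Qed.
Lemma dotpDr x y z : dotp x (y + z) = dotp x y + dotp x z.
Proof. exact: linearDr. Qed.
Lemma dotpBl x y z : dotp (x - y) z = dotp x z - dotp y z.
Proof. exact: linearBl. Qed.
Lemma dotpBr x y z : dotp x (y - z) = dotp x y - dotp x z.
Proof. exact: linearBr. Qed.
Lemma dotpNr x y : dotp x (- y) = - dotp x y.
Proof. exact: linearNr. Qed.
Lemma dotpZl a x y : dotp (a *: x) y = a * dotp x y.
Proof. exact: linearZl_LR. Qed.
Lemma dotpZr a x y : dotp x (a *: y) = conjc a * dotp x y.
Proof. exact: linearZr_LR. Qed.
Lemma dotpC x y : dotp x y = conjc (dotp y x).
Proof. by rewrite hermC expr0 mul1r. Qed.

Lemma norm_hnorm x : `|x| = (hnorm x)%:C.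
Proof. by rewrite /hnorm RRe_real// ger0_real. Qed.

Lemma norm_normc a : `|a| = (normc a)%:C. Proof. by []. Qed.

Lemma dotpxx x : dotp x x = (hnorm x ^+ 2)%:C.
Proof. by rewrite dotp_norm norm_hnorm rmorphXn. Qed.

Lemma hnorm_ge0 x : 0 <= hnorm x.
Proof. by rewrite -ler0c -norm_hnorm. Qed.

Lemma ler_hnormD x y : hnorm (x + y) <= hnorm x + hnorm y.
Proof. by rewrite -lecR rmorphD/= -!norm_hnorm ler_normD. Qed.

Lemma hnorm_opp x : hnorm (- x) = hnorm x.
Proof. by rewrite /hnorm normrN. Qed.

Lemma hnorm_distC x y : hnorm (x - y) = hnorm (y - x).
Proof. by rewrite -hnorm_opp opprB. Qed.

Lemma hnormZ a x : hnorm (a *: x) = normc a * hnorm x.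
Proof. by apply: complexI; rewrite -norm_hnorm normrZ rmorphM/= norm_hnorm. Qed.

Lemma hnorm0 : hnorm (0 : H) = 0.
Proof. by rewrite /hnorm normr0. Qed.

Lemma hnorm_le0 x : hnorm x <= 0 -> x = 0.
Proof.
move=> x0; apply/normr0_eq0; rewrite norm_hnorm.
by rewrite (le_anti (_ : hnorm x <= 0 <= hnorm x)) ?x0 ?hnorm_ge0.
Qed.

Lemma normc_ge0 a : 0 <= normc a.
Proof. by rewrite -ler0c -norm_normc. Qed.

Lemma normc_le0 a : normc a <= 0 -> a = 0.
Proof.
move=> a0; apply/normr0_eq0; rewrite norm_normc.
by rewrite (le_anti (_ : normc a <= 0 <= normc a)) ?a0 ?normc_ge0.
Qed.

Lemma normc_conj a : normc (conjc a) = normc a.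
Proof. by case: a => u v /=; rewrite sqrrN. Qed.

Lemma conj_mul_normc a : conjc a * a = real_complex R (normc a ^+ 2).
Proof. by rewrite mulrC -sqr_normc norm_normc rmorphXn. Qed.

Lemma normc_real r : 0 <= r -> normc r%:C = r.
Proof. by move=> r0; rewrite /= expr0n addr0 sqrtr_sqr ger0_norm. Qed.

Lemma Re_le_normc a : Re a <= normc a.
Proof.
by rewrite -lecR -norm_normc; apply: le_trans (normc_ge_Re _); rewrite lecR ler_norm.
Qed.

Lemma ReD a b : Re (a + b) = Re a + Re b. Proof. by case: a; case: b. Qed.
Lemma ReN a : Re (- a) = - Re a. Proof. by case: a. Qed.
Lemma ReJ a : Re (conjc a) = Re a. Proof. by case: a. Qed.
Lemma ReZ r a : Re (r%:C * a) = r * Re a.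
Proof. by case: a => u v /=; rewrite mul0r subr0. Qed.

Lemma hnormD_sqr x y :
  hnorm (x + y) ^+ 2 = hnorm x ^+ 2 + 2 * Re (dotp x y) + hnorm y ^+ 2.
Proof.
have E z : hnorm z ^+ 2 = Re (dotp z z) by rewrite dotpxx.
rewrite !E dotpDl !dotpDr !ReD [dotp y x]dotpC ReJ; lra.
Qed.

(** Squaring the triangle inequality, which the norm satisfies by assumption,
    leaves exactly this bound on the cross term. *)
Lemma cauchy_schwarz_Re x y : Re (dotp x y) <= hnorm x * hnorm y.
Proof.
have := lerXn2r 2 (hnorm_ge0 (x + y)) _ (ler_hnormD x y).
rewrite nnegrE addr_ge0 ?hnorm_ge0// => /(_ isT); rewrite hnormD_sqr; lra.
Qed.

(** Rotating [x] by the phase of [dotp x y] turns the modulus of the inner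
    product into a real part. *)
Lemma cauchy_schwarz x y : normc (dotp x y) <= hnorm x * hnorm y.
Proof.
set n := normc _; have n0 : 0 <= n by exact: normc_ge0.
have := cauchy_schwarz_Re (conjc (dotp x y) *: x) y.
rewrite dotpZl conj_mul_normc hnormZ normc_conj -/n /=.
have [->|nN0 h] := eqVneq n 0; first by rewrite mulr_ge0 ?hnorm_ge0.
have n_gt0 : 0 < n by rewrite lt_def nN0.
by rewrite -(ler_pM2l n_gt0) mulrA -expr2.
Qed.

Lemma dotp_eq x y : (forall z, dotp z x = dotp z y) -> x = y.
Proof.
move=> e; apply/eqP; rewrite -subr_eq0 -normr_eq0 -sqrf_eq0 -dotp_norm.
by rewrite dotpBr e subrr.
Qed.

End InnerProduct.

(** * Limits with an explicit rate *)

Section Limits.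
Local Open Scope classical_set_scope.
Context {R : realType} {H : hilbertType R}.
Implicit Types (x y z l m : H) (u v : nat -> H).

Definition fast_cvg (u : nat -> H) (l : H) :=
  exists K : R, forall n, hnorm (u n - l) <= K / n.+1%:R.

Lemma le0_of_rate (a K : R) : (forall n, a <= K / n.+1%:R) -> a <= 0.
Proof.
move=> aK; rewrite leNgt; apply/negP => a0.
have [N] : exists N : nat, K / a < N%:R.
  exists (Num.bound `|K / a|).
  exact: le_lt_trans (ler_norm _) (archi_boundP (normr_ge0 _)).
rewrite ltr_pdivrMr // => KN.
have := aK N; rewrite ler_pdivlMr ?ltr0n// leNgt => /negP; apply.
apply: (lt_le_trans KN); rewrite mulrC ler_pM2l// ler_nat; exact: leqnSn.
Qed.

(** Completeness of the space enters only here. *)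
Lemma fast_cauchy_cvg (u : nat -> H) (K : R) :
  (forall n k : nat, (n <= k)%N -> hnorm (u k - u n) <= K / n.+1%:R) ->
  exists l, fast_cvg u l.
Proof.
move=> uK.
have K0 : 0 <= K by have := uK 0 0 isT; rewrite subrr hnorm0 divr1.
have small (e : R) : 0 < e ->
    exists N : nat, forall n, (N <= n)%N -> K / n.+1%:R < e.
  move=> e0; exists (Num.bound (K / e)) => n Nn.
  rewrite ltr_pdivrMr ?ltr0n// mulrC -ltr_pdivrMr//.
  apply: (lt_le_trans (archi_boundP _)); first by rewrite divr_ge0// ltW.
  by rewrite ler_nat leqW.
have /cauchy_cvg/cvg_ex[l ul] : cauchy (u @ \oo).
  apply: cauchy_exP => e; rewrite ltcE /= => /andP[/eqP ei er].
  have [N NK] := small _ er; exists (u N).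
  exists N => // m /= Nm; rewrite -ball_normE/= norm_hnorm ltcE/= ei eqxx/=.
  by rewrite hnorm_distC; apply: le_lt_trans (NK _ (leqnn N)); exact: uK.
exists l, K => n.
apply/ler_addgt0Pr => e e0.
have /cvgrPdist_lt/(_ e%:C) : u @ \oo --> l by [].
rewrite ltcR => /(_ e0)[N _ /(_ (maxn n N))] /=.
rewrite leq_maxr norm_hnorm ltcR => /(_ isT) lu.
have -> : u n - l = (u n - u (maxn n N)) + (u (maxn n N) - l).
  by rewrite addrA subrK.
apply: le_trans (ler_hnormD _ _) _; apply: lerD.
  by rewrite hnorm_distC uK// leq_maxl.
by rewrite hnorm_distC ltW.
Qed.

Lemma fast_cvg_cst x : fast_cvg (fun=> x) x.
Proof. by exists 0 => n; rewrite subrr hnorm0 mul0r. Qed.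

Lemma fast_cvgS u l : fast_cvg u l -> fast_cvg (fun n => u n.+1) l.
Proof.
move=> [K uK]; exists K => n; apply: le_trans (uK n.+1) _.
have K0 : 0 <= K by have := le_trans (hnorm_ge0 _) (uK 0); rewrite divr1.
by rewrite ler_wpM2l// lef_pV2 ?posrE ?ltr0n// ler_nat.
Qed.

Lemma fast_cvgD u v l m :
  fast_cvg u l -> fast_cvg v m -> fast_cvg (fun n => u n + v n) (l + m).
Proof.
move=> [K uK] [L vL]; exists (K + L) => n.
rewrite opprD addrACA mulrDl; apply: le_trans (ler_hnormD _ _) _; exact: lerD.
Qed.

Lemma fast_cvgZ (a : R[i]) u l :
  fast_cvg u l -> fast_cvg (fun n => a *: u n) (a *: l).
Proof.
move=> [K uK]; exists (normc a * K) => n.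
by rewrite -scalerBr hnormZ -mulrA ler_wpM2l ?normc_ge0.
Qed.

Lemma fast_cvg_unique u l m : fast_cvg u l -> fast_cvg u m -> l = m.
Proof.
move=> [K uK] [L uL]; apply/eqP; rewrite -subr_eq0; apply/eqP/hnorm_le0.
apply: (le0_of_rate (K := K + L)) => n.
have -> : l - m = (l - u n) + (u n - m) by rewrite addrA subrK.
rewrite mulrDl; apply: le_trans (ler_hnormD _ _) (lerD _ _) => //.
by rewrite hnorm_distC.
Qed.

Lemma fast_cvg_hnorm_le u l (M : R) :
  fast_cvg u l -> (forall n, hnorm (u n) <= M) -> hnorm l <= M.
Proof.
move=> [K uK] uM; rewrite -subr_le0; apply: (le0_of_rate (K := K)) => n.
have -> : l = u n + (l - u n) by rewrite addrC subrK.
have := ler_hnormD (u n) (l - u n); have := uK n; have := uM n.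
rewrite (hnorm_distC l) => h1 h2 h3.
by rewrite lerBlDr; apply: (le_trans h3); rewrite addrC; exact: lerD.
Qed.

(** Taking [u] and [v] to be the values of a sequence of operators at two points
    passes the symmetry of these operators to their pointwise limit. *)
Lemma fast_cvg_dotp u v l m x y :
  fast_cvg u l -> fast_cvg v m -> (forall n, dotp (u n) x = dotp y (v n)) ->
  dotp l x = dotp y m.
Proof.
move=> [K uK] [L vL] uv; apply/eqP; rewrite -subr_eq0; apply/eqP/normc_le0.
apply: (le0_of_rate (K := K * hnorm x + hnorm y * L)) => n.
have -> : dotp l x - dotp y m = dotp (l - u n) x + dotp y (v n - m).
  by rewrite dotpBl dotpBr uv addrA subrK.
apply: le_trans (le_normcD _ _) _.
rewrite mulrDl; apply: lerD; apply: le_trans (cauchy_schwarz _ _) _.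
  by rewrite hnorm_distC mulrAC ler_wpM2r ?hnorm_ge0.
by rewrite -mulrA ler_wpM2l ?hnorm_ge0.
Qed.

End Limits.

(** * The Riesz representation theorem *)

Section Riesz.
Context {R : realType} {H : hilbertType R}.
Implicit Types x y z h : H.

(** The functional [J x = ||x||^2 - 2 Re (f x)] equals [||x - z||^2 - ||z||^2] as
    soon as [z] represents [f], so the representing vector has to be the point
    where [J] is minimal. *)
Lemma riesz (f : H -> R[i]) (M : R) :
    (forall a x y, f (a *: x + y) = a * f x + f y) -> 0 <= M ->
    (forall x, normc (f x) <= M * hnorm x) ->
  exists z, forall x, f x = dotp x z.
Proof.
move=> flin M0 fM.
have fZ a x : f (a *: x) = a * f x.
  have f0 : f 0 = 0 by have := flin (-1) 0 0; rewrite scaler0 addr0 mulN1r addNr.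
  by have := flin a x 0; rewrite !addr0 f0 addr0.
have fD x y : f (x + y) = f x + f y by have := flin 1 x y; rewrite scale1r mul1r.
pose J x := hnorm x ^+ 2 - 2 * Re (f x).
have Jexp x h : J (x + h) = J x + 2 * (Re (dotp x h) - Re (f h))
                            + hnorm h ^+ 2.
  by rewrite /J hnormD_sqr fD ReD; ring.
have fleR x : Re (f x) <= M * hnorm x.
  exact: le_trans (Re_le_normc _) (fM x).
have Jinf : has_inf [set J x | x in [set: H]]%classic.
  split; first by exists (J 0), 0.
  exists (- M ^+ 2) => _ [x _ <-]; rewrite /J.
  have := fleR x; have := sqr_ge0 (M - hnorm x).
  rewrite sqrrB; lra.
pose i := inf [set J x | x in [set: H]]%classic.
have iJ x : i <= J x by apply: ge_inf; [exact: Jinf.2 | exists x].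
(* The defect is squared because the parallelogram law controls the square of
   the distance. *)
have /choice[u uJ] : forall n : nat, exists x, J x <= i + (n.+1%:R^-1) ^+ 2.
  move=> n; have e0 : 0 < (n.+1%:R^-1 : R) ^+ 2.
    by rewrite exprn_gt0// invr_gt0 ltr0n.
  by have [_ [x _ <-] xi] := inf_adherent e0 Jinf; exists x; exact: ltW.
(* Parallelogram law, with [J] evaluated at the midpoint. *)
have Jpar x y : hnorm (x - y) ^+ 2 <= 2 * (J x + J y - 2 * i).
  have := iJ (2^-1%:C *: (x + y)).
  rewrite {1}/J hnormZ normc_real ?invr_ge0// fZ fD ReZ ReD exprMn hnormD_sqr.
  rewrite hnormD_sqr hnorm_opp dotpNr ReN.
  rewrite /J; lra.
have [z [K uz]] : exists z, fast_cvg u z.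
  apply: (@fast_cauchy_cvg _ _ _ 2) => n m nm.
  have p0 : 0 <= 2 / (n.+1%:R : R) by rewrite divr_ge0.
  rewrite -(@ler_pXn2r _ 2) ?nnegrE ?hnorm_ge0//.
  apply: le_trans (Jpar _ _) _.
  have : (m.+1%:R^-1 : R) ^+ 2 <= (n.+1%:R^-1) ^+ 2.
    by rewrite ler_pXn2r ?nnegrE// lef_pV2 ?posrE ?ltr0n// ler_nat.
  rewrite exprMn; have := uJ n; have := uJ m.
  by move: (m.+1%:R^-1 ^+ 2) (n.+1%:R^-1 ^+ 2) => a b; lra.
have Jz : J z <= i.
  rewrite -subr_le0.
  apply: (le0_of_rate (K := 1 + 2 * (hnorm z + M) * K)) => n.
  have Ju := Jexp z (u n - z); rewrite addrC subrK in Ju.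
  have n1 : (n.+1%:R^-1 : R) ^+ 2 <= n.+1%:R^-1.
    rewrite expr2 ler_piMr ?invr_ge0// invf_le1 ?ltr0n// ler1n //.
  have h1 : - Re (dotp z (u n - z)) <= hnorm z * hnorm (u n - z).
    apply: le_trans (cauchy_schwarz _ _); rewrite -normcN.
    by apply: le_trans (Re_le_normc _); case: (dotp _ _).
  have h2 := fleR (u n - z); have h3 := uJ n; have h4 := sqr_ge0 (hnorm (u n - z)).
  have : 2 * (hnorm z + M) * hnorm (u n - z) <= 2 * (hnorm z + M) * (K / n.+1%:R).
    by rewrite ler_wpM2l// mulr_ge0// addr_ge0// hnorm_ge0.
  move: Ju h1 h2 h3 h4 n1.
  move: (n.+1%:R^-1) => p; move: (p ^+ 2) => q.
  lra.
exists z.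
have key h : Re (f h) = Re (dotp h z).
  rewrite [dotp h z]dotpC ReJ.
  set c := Re (dotp z h) - Re (f h).
  suff : c ^+ 2 <= 0.
    by rewrite le_eqVlt ltNge sqr_ge0 orbF sqrf_eq0 subr_eq0 => /eqP.
  set k := hnorm h ^+ 2; have k0 : 0 <= k by exact: sqr_ge0.
  (* The quadratic [2 t c + t^2 k] is nonnegative for all [t]; its minimum is at
     [- c / k], and [k + 1] in place of [k] covers [k = 0]. *)
  pose t := - c / (k + 1).
  have := le_trans Jz (iJ (z + t%:C *: h)).
  rewrite Jexp dotpZr fZ conjc_real !ReZ -mulrBr -/c hnormZ exprMn -/k.
  have -> : normc t%:C ^+ 2 = t ^+ 2.
    by rewrite /= expr0n addr0 sqr_sqrtr// sqr_ge0.
  rewrite -addrA lerDl.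
  have -> : 2 * (t * c) + t ^+ 2 * k = - (c ^+ 2 * ((k + 2) / (k + 1) ^+ 2)).
    by rewrite /t; field; lra.
  by rewrite oppr_ge0 pmulr_lle0// divr_gt0 ?exprn_gt0; lra.
(* The imaginary part of [f x] is minus the real part of [f ('i *: x)]. *)
move=> x; have := key x; have := key ('i *: x); rewrite fZ dotpZl.
case: (f x) => a b; case: (dotp x z) => c d /=.
rewrite !mul0r !mul1r !sub0r => /oppr_inj -> -> //.
Qed.

End Riesz.

(** * Adjoints *)

Section Operators.
Context {R : realType} {H : hilbertType R}.
Implicit Types (x y z : H) (T S : bounded_op H).

Lemma bounded_op_of (g : H -> H) (M : R) :
    (forall a x y, g (a *: x + y) = a *: g x + g y) ->
    (forall x, hnorm (g x) <= M * hnorm x) ->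
  exists S, forall x, S x = g x.
Proof.
move=> glin gM.
pose lin := GRing.isLinear.Build R[i] H H *:%R g glin.
pose g' : {linear H -> H} := HB.pack g lin.
have bnd : exists N : R, forall x, hnorm (g' x) <= N * hnorm x by exists M.
by exists (BoundedOp bnd).
Qed.

Lemma bop_bound_gt0 T :
  exists2 M : R, 0 < M & forall x, hnorm (T x) <= M * hnorm x.
Proof.
have [M TM] := bop_bounded T; exists (`|M| + 1); first by rewrite ltr_wpDl.
move=> x; apply: le_trans (TM x) _; rewrite ler_wpM2r ?hnorm_ge0//.
by rewrite (le_trans (ler_norm M))// lerDl.
Qed.

(** Only the pairing matters, so this applies before [g] is known to be an
    operator. *)
Lemma adjoint_pair_bound T (g : H -> H) (M : R) : 0 <= M ->
    (forall x, hnorm (T x) <= M * hnorm x) ->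
    (forall x y, dotp (T x) y = dotp x (g y)) ->
  forall y, hnorm (g y) <= M * hnorm y.
Proof.
move=> M0 TM gE y.
have [->|n0] := eqVneq (hnorm (g y)) 0; first by rewrite mulr_ge0 ?hnorm_ge0.
have n_gt0 : 0 < hnorm (g y) by rewrite lt_def n0 hnorm_ge0.
rewrite -(ler_pM2r n_gt0) -expr2.
have -> : hnorm (g y) ^+ 2 = Re (dotp (T (g y)) y) by rewrite gE dotpxx.
apply: le_trans (cauchy_schwarz_Re _ _) _.
by rewrite mulrAC ler_wpM2r ?hnorm_ge0.
Qed.

Lemma adjoint_exists T : exists S, is_adjoint T S.
Proof.
have [M M0 TM] := bop_bound_gt0 T.
have /choice[g gE] : forall y, exists z, forall x, dotp (T x) y = dotp x z.
  move=> y; apply: (@riesz _ _ _ (M * hnorm y)).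
  - by move=> a u v; rewrite linearP dotpDl dotpZl.
  - by rewrite mulr_ge0 ?hnorm_ge0// ltW.
  - move=> x; apply: le_trans (cauchy_schwarz _ _) _.
    by rewrite mulrAC ler_wpM2r ?hnorm_ge0.
have [|y|S SE] := @bounded_op_of g M.
- move=> a u v; apply: dotp_eq => z.
  by rewrite -gE !dotpDr !dotpZr !gE.
- exact: (adjoint_pair_bound (ltW M0) TM (fun x y => gE y x)).
by exists S => x y; rewrite SE gE.
Qed.

Lemma adjointP T : is_adjoint T (adjoint T).
Proof. by have [S TS] := adjoint_exists T; exact: (xgetI T TS). Qed.

Lemma dotp_adjointl T x y : dotp (adjoint T x) y = dotp x (T y).
Proof. by rewrite dotpC -adjointP -dotpC. Qed.

End Operators.

(** * Square roots and moduli *)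

Section SquareRoot.
Context {R : realType} {H : hilbertType R}.
Implicit Types (x y z : H) (T S : bounded_op H).

(** The iteration of [sqrt_iter] in dimension one with [C = 1]: it dominates the
    norms and the increments of all the others. *)
Fixpoint sqrt_majorant (n : nat) : R :=
  if n is k.+1 then 2^-1 * (1 + sqrt_majorant k ^+ 2) else 0.

Lemma sqrt_majorant_bounds n :
  [/\ 0 <= sqrt_majorant n, sqrt_majorant n <= 1 &
      1 - sqrt_majorant n <= 2 / n.+1%:R].
Proof.
(* The defect [d = 1 - sqrt_majorant n] evolves by [d - d^2 / 2], which is
   increasing on [[0, 1]]; compare its value at [2 / p]. *)
have st (d p : R) : 1 <= p -> 0 <= d <= 1 -> d <= 2 / p ->
    d - 2^-1 * d ^+ 2 <= 2 / (p + 1).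
  move=> p1 d01; rewrite !ler_pdivlMr; [|lra|lra] => dp.
  nra.
elim: n => [|n [g0 g1 gn]]; first by split => //=; lra.
split => /=.
- by have := sqr_ge0 (sqrt_majorant n); lra.
- have : sqrt_majorant n ^+ 2 <= 1 by rewrite expr_le1.
  lra.
- rewrite -[n.+2%:R]natr1; apply: le_trans (st (1 - sqrt_majorant n) _ _ _ gn).
  + by rewrite le_eqVlt; apply/orP; left; apply/eqP; field.
  + by rewrite ler1n.
  + lra.
Qed.

Lemma sqrt_majorant_le n m : (n <= m)%N -> sqrt_majorant n <= sqrt_majorant m.
Proof.
move=> /subnK <-; elim: (m - n)%N => //= k /le_trans; apply.
have := sqr_ge0 (1 - sqrt_majorant (k + n)); rewrite sqrrB; lra.
Qed.

(** Its limit is [1 - (1 - C)^(1/2)]. *)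
Fixpoint sqrt_iter (C : H -> H) (n : nat) (x : H) : H :=
  if n is k.+1 then 2^-1%:C *: (C x + sqrt_iter C k (sqrt_iter C k x)) else 0.

Section Iteration.
Context (C : H -> H).
Context (Clin : forall a x y, C (a *: x + y) = a *: C x + C y).
Context (Csym : forall x y, dotp (C x) y = dotp x (C y)).
Context (C1 : forall x, hnorm (C x) <= hnorm x).
Local Notation Y := (sqrt_iter C).

Lemma sqrt_iter_linear n a x y : Y n (a *: x + y) = a *: Y n x + Y n y.
Proof.
elim: n a x y => [|n IH] a x y /=; first by rewrite scaler0 addr0.
by rewrite Clin !IH addrACA -[a *: _ + a *: _]scalerDr [LHS]scalerDr !scalerA mulrC.
Qed.

Lemma sqrt_iterB n x y : Y n (x - y) = Y n x - Y n y.
Proof. by rewrite addrC -scaleN1r sqrt_iter_linear scaleN1r addrC. Qed.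

Lemma sqrt_iter_sym n x y : dotp (Y n x) y = dotp x (Y n y).
Proof.
elim: n x y => [|n IH] x y /=; first by rewrite dotp0l dotp0r.
by rewrite dotpZl dotpZr conjc_real dotpDl dotpDr Csym !IH.
Qed.

Lemma hnorm_half x : hnorm (2^-1%:C *: x) = 2^-1 * hnorm x.
Proof. by rewrite hnormZ normc_real// invr_ge0. Qed.

Lemma sqrt_iter_le n x : hnorm (Y n x) <= sqrt_majorant n * hnorm x.
Proof.
elim: n x => [|n IH] x /=; first by rewrite hnorm0 mul0r.
have [g0 _ _] := sqrt_majorant_bounds n.
rewrite hnorm_half -mulrA ler_wpM2l ?invr_ge0// mulrDl mul1r expr2 -mulrA.
apply: le_trans (ler_hnormD _ _) (lerD (C1 x) _).
by apply: le_trans (IH _) _; rewrite ler_wpM2l.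
Qed.

(** Since [Y'^2 - Y^2 = Y' (Y' - Y) + (Y' - Y) Y] for consecutive iterates [Y] and
    [Y'], the bounds on the iterates and on the previous increment multiply to
    those of the scalar iteration, without any commutation of operators. *)
Lemma sqrt_iter_step n x :
  hnorm (Y n.+1 x - Y n x) <= (sqrt_majorant n.+1 - sqrt_majorant n) * hnorm x.
Proof.
elim: n x => [|n IH] x.
  rewrite /= addr0 !subr0 expr0n addr0 mulr1 hnorm_half.
  by rewrite ler_wpM2l ?invr_ge0.
have -> : Y n.+2 x - Y n.+1 x =
    2^-1%:C *: (Y n.+1 (Y n.+1 x - Y n x) + (Y n.+1 (Y n x) - Y n (Y n x))).
  rewrite sqrt_iterB addrA subrK /= -scalerBr; congr (_ *: _).
  by rewrite opprD addrACA subrr add0r.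
rewrite hnorm_half.
have [g0 _ _] := sqrt_majorant_bounds n; have [g1 _ _] := sqrt_majorant_bounds n.+1.
have gg : 0 <= sqrt_majorant n.+1 - sqrt_majorant n.
  by rewrite subr_ge0 sqrt_majorant_le.
have e1 : hnorm (Y n.+1 (Y n.+1 x - Y n x))
       <= sqrt_majorant n.+1 * ((sqrt_majorant n.+1 - sqrt_majorant n) * hnorm x).
  by apply: le_trans (sqrt_iter_le _ _) _; rewrite ler_wpM2l.
have e2 : hnorm (Y n.+1 (Y n x) - Y n (Y n x))
       <= (sqrt_majorant n.+1 - sqrt_majorant n) * (sqrt_majorant n * hnorm x).
  by apply: le_trans (IH _) _; rewrite ler_wpM2l// sqrt_iter_le.
have -> : (sqrt_majorant n.+2 - sqrt_majorant n.+1) * hnorm x =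
    2^-1 * (sqrt_majorant n.+1 * ((sqrt_majorant n.+1 - sqrt_majorant n) * hnorm x)
            + (sqrt_majorant n.+1 - sqrt_majorant n) * (sqrt_majorant n * hnorm x)).
  rewrite [sqrt_majorant n.+2]/= [in X in (_ - X) * _]/=.
  set g := sqrt_majorant n.+1.
  have -> : g = 2^-1 * (1 + sqrt_majorant n ^+ 2) by [].
  by field.
by rewrite ler_wpM2l ?invr_ge0//; apply: le_trans (ler_hnormD _ _) (lerD e1 e2).
Qed.

Lemma sqrt_iter_cvg x : exists l, fast_cvg (Y ^~ x) l.
Proof.
apply: (@fast_cauchy_cvg _ _ _ (2 * hnorm x)) => n m nm.
have [_ _ gn] := sqrt_majorant_bounds n; have [_ gm _] := sqrt_majorant_bounds m.
apply: (@le_trans _ _ ((sqrt_majorant m - sqrt_majorant n) * hnorm x)); last first.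
  rewrite mulrAC ler_wpM2r ?hnorm_ge0//; apply: le_trans gn.
  by rewrite lerB.
move: nm => /subnK <-; elim: (m - n)%N => [|k IH].
  by rewrite !subrr hnorm0 mul0r.
have -> : Y (k.+1 + n) x - Y n x
    = (Y (k + n).+1 x - Y (k + n) x) + (Y (k + n) x - Y n x).
  by rewrite addrA subrK.
apply: le_trans (ler_hnormD _ _) _.
have := sqrt_iter_step (k + n) x; rewrite addSn.
set A := hnorm _; set B := hnorm _; rewrite mulrBl => h.
rewrite mulrBl in IH; rewrite mulrBl.
have := lerD h IH; rewrite addrA subrK //.
Qed.

End Iteration.

(** For symmetric [T] the contraction hypothesis on [1 - T] plays the part of
    positivity: it puts the spectrum of [T] in [[0, 2]].  The square root is
    [1 - V], positive because [V] is symmetric and a contraction. *)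
Lemma sqrt_of_contraction T :
    (forall x y, dotp (T x) y = dotp x (T y)) ->
    (forall x, hnorm (x - T x) <= hnorm x) ->
  exists S, positive_op S /\ forall x, S (S x) = T x.
Proof.
move=> Tsym T1; pose C x := x - T x.
have Clin a x y : C (a *: x + y) = a *: C x + C y.
  by rewrite /C linearP scalerBr opprD addrACA.
have Csym x y : dotp (C x) y = dotp x (C y).
  by rewrite /C dotpBl dotpBr Tsym.
have /choice[V YV] := sqrt_iter_cvg Clin T1.
have Vlin a x y : V (a *: x + y) = a *: V x + V y.
  apply: fast_cvg_unique (YV _) _.
  have [K YK] := fast_cvgD (fast_cvgZ a (YV x)) (YV y).
  by exists K => n; rewrite sqrt_iter_linear.
have VB x y : V (x - y) = V x - V y.
  by rewrite addrC -scaleN1r Vlin scaleN1r addrC.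
have V1 x : hnorm (V x) <= hnorm x.
  apply: fast_cvg_hnorm_le (YV x) _ => n.
  apply: le_trans (sqrt_iter_le T1 _ _) _; have [_ g1 _] := sqrt_majorant_bounds n.
  by rewrite -[leRHS]mul1r ler_wpM2r ?hnorm_ge0.
have Vsym x y : dotp (V x) y = dotp x (V y).
  by apply: (fast_cvg_dotp (YV x) (YV y)) => n; exact: sqrt_iter_sym.
have VV x : V x = 2^-1%:C *: (C x + V (V x)).
  apply: fast_cvg_unique (fast_cvgS (YV x)) _.
  apply: fast_cvgZ; apply: fast_cvgD; first exact: fast_cvg_cst.
  have [K YK] := YV x; have [L YL] := YV (V x); exists (K + L) => n.
  have -> : sqrt_iter C n (sqrt_iter C n x) - V (V x) =
      sqrt_iter C n (sqrt_iter C n x - V x) + (sqrt_iter C n (V x) - V (V x)).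
    by rewrite sqrt_iterB// addrA subrK.
  rewrite mulrDl; apply: le_trans (ler_hnormD _ _) (lerD _ (YL n)).
  apply: le_trans (sqrt_iter_le T1 _ _) _; have [_ g1 _] := sqrt_majorant_bounds n.
  by apply: le_trans (YK n); rewrite -[leRHS]mul1r ler_wpM2r ?hnorm_ge0.
have [||S SE] := @bounded_op_of _ _ (fun x => x - V x) 2.
- by move=> a x y; rewrite Vlin scalerBr opprD addrACA.
- move=> x; apply: le_trans (ler_hnormD _ _) _; rewrite hnorm_opp.
  by have := V1 x; lra.
exists S; split => x.
  have sym : dotp (S x) x = conjc (dotp (S x) x).
    by rewrite -dotpC !SE dotpBl dotpBr Vsym.
  rewrite lecE/=; apply/andP; split.
    by move: sym; case: (dotp _ _) => a b /= [] ?; apply/eqP; lra.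
  rewrite SE dotpBl -[_ - _]/(_ + - _) ReD ReN dotpxx subr_ge0 /= expr2.
  by apply: le_trans (cauchy_schwarz_Re _ _) _; rewrite ler_wpM2r ?hnorm_ge0.
rewrite !SE VB.
have : 2%:C *: V x = C x + V (V x).
  by rewrite {1}VV scalerA -rmorphM/= mulfV// scale1r.
rewrite (_ : 2%:C = 1 + 1); last by rewrite (rmorphD (real_complex R) 1 1).
rewrite scalerDl scale1r /C => e.
have -> : x - V x - (V x - V (V x)) = x + V (V x) - (V x + V x).
  by rewrite opprB opprD addrACA.
by rewrite e opprD opprB addrACA subrr addr0 addrC subrK.
Qed.

(** With [||T|| <= M] and [c = M^-2], expanding the square gives
    [||x - c T^*T x||^2 <= ||x||^2 - c ||Tx||^2], so [c T^*T] has a square root;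
    multiplying it by [M] yields the modulus. *)
Lemma modulus_exists T : exists P, is_modulus T P.
Proof.
have [M M0 TM] := bop_bound_gt0 T.
have Mn0 : M != 0 by rewrite gt_eqF.
pose c : R := M ^- 2.
have c0 : 0 <= c by rewrite invr_ge0 exprn_ge0// ltW.
have A1 := adjoint_pair_bound (ltW M0) TM (@adjointP _ _ T).
have [||Q QE] := @bounded_op_of _ _ (fun x => c%:C *: adjoint T (T x)) (c * (M * M)).
- by move=> a x y; rewrite (linearP T) (linearP (adjoint T)) scalerDr !scalerA mulrC.
- move=> x; rewrite hnormZ normc_real// -!mulrA ler_wpM2l//.
  by apply: le_trans (A1 _) _; rewrite ler_wpM2l// ltW.
have [||S [Spos SS]] := @sqrt_of_contraction Q.
- by move=> x y; rewrite !QE dotpZl dotpZr conjc_real dotp_adjointl adjointP.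
- move=> x; rewrite -(@ler_pXn2r _ 2) ?nnegrE ?hnorm_ge0//.
  rewrite hnormD_sqr hnorm_opp dotpNr ReN QE dotpZr conjc_real ReZ -adjointP.
  rewrite dotpxx hnormZ normc_real// exprMn.
  have : c ^+ 2 * hnorm (adjoint T (T x)) ^+ 2 <= c * hnorm (T x) ^+ 2.
    have -> : c * hnorm (T x) ^+ 2 = c ^+ 2 * (M * hnorm (T x)) ^+ 2.
      by rewrite /c; field.
    rewrite ler_wpM2l ?exprn_ge0// ler_pXn2r ?nnegrE ?hnorm_ge0//.
    by rewrite mulr_ge0 ?hnorm_ge0// ltW.
  have : 0 <= c * hnorm (T x) ^+ 2 by rewrite mulr_ge0// exprn_ge0// hnorm_ge0.
  rewrite [Re _]/=; move: (c ^+ 2 * _) (c * _) => p q; lra.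
have [N _ SN] := bop_bound_gt0 S.
have [||P PE] := @bounded_op_of _ _ (fun x => M%:C *: S x) (M * N).
- by move=> a x y; rewrite (linearP S) scalerDr !scalerA mulrC.
- by move=> x; rewrite hnormZ (normc_real (ltW M0)) -mulrA ler_wpM2l// ltW.
exists P; split => x; first by rewrite PE dotpZl mulr_ge0// ler0c ltW.
rewrite !PE (linearZ_LR S) scalerA SS QE scalerA -!rmorphM/=.
rewrite (_ : M * M * c = 1) ?scale1r//.
by rewrite /c; field.
Qed.

Lemma modulusP T : is_modulus T (modulus T).
Proof. by have [P TP] := modulus_exists T; exact: (xgetI T TP). Qed.

End SquareRoot.

(** * Suprema defining the radii *)

Section Radii.
Context {R : realType} {H : hilbertType R}.
Implicit Types (x y z : H) (F : H -> H).

(** An unbounded or empty set is covered by the convention that its [sup] is [0]. *)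
Lemma sup_ge0 (E : set R) : (forall e, E e -> 0 <= e) -> 0 <= sup E.
Proof.
move=> E_ge0; have [hE|/sup_out->//] := pselect (has_sup E).
by have [e Ee] := hE.1; exact: le_trans (E_ge0 _ Ee) (ub_le_sup hE.2 Ee).
Qed.

Definition bounded_map F := exists M : R, forall x, hnorm (F x) <= M * hnorm x.

Lemma le_opnorm F x : bounded_map F -> hnorm x <= 1 -> hnorm (F x) <= opnorm F.
Proof.
move=> [M FM] x1; apply: ub_le_sup; last by exists x.
exists `|M| => _ [y /= y1 <-]; apply: le_trans (FM y) _.
apply: le_trans (ler_wpM2r (hnorm_ge0 _) (ler_norm M)) _.
by rewrite -[leRHS]mulr1 ler_wpM2l.
Qed.

Lemma le_numerical_radius F x : bounded_map F -> hnorm x = 1 ->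
  normc (dotp (F x) x) <= numerical_radius F.
Proof.
move=> [M FM] x1; apply: ub_le_sup; last by exists x.
exists M => _ [y /= y1 <-]; apply: le_trans (cauchy_schwarz _ _) _.
by have := FM y; rewrite y1 !mulr1.
Qed.

Lemma numerical_radius_ge0 F : 0 <= numerical_radius F.
Proof. by apply: sup_ge0 => _ [x _ <-]; exact: normc_ge0. Qed.

(** The empty set has to be allowed: the unit sphere of the zero space is empty. *)
Lemma sup_sqr_le (E : set R) (c : R) : 0 <= c ->
  (forall e, E e -> 0 <= e /\ e ^+ 2 <= c) -> sup E ^+ 2 <= c.
Proof.
move=> c0 Ec; have [->|E0] := eqVneq E set0; first by rewrite sup0 expr0n.
have s0 : 0 <= sup E by apply: sup_ge0 => e /Ec[].
rewrite -[c]sqr_sqrtr// ler_pXn2r ?nnegrE ?sqrtr_ge0//.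
apply: ge_sup; first exact/set0P.
move=> e /Ec[e0 ec]; rewrite -(@ler_pXn2r _ 2) ?nnegrE ?sqrtr_ge0//.
by rewrite sqr_sqrtr.
Qed.

End Radii.

(** * The inequality *)

Theorem theorem2p2 (R : realType) (H : hilbertType R) (A B : bounded_op H) :
  euclidean_radius A B ^+ 2 <=
  Num.sqrt
    (opnorm
       ((numerical_radius A ^+ 2)%:C
          *: (modulus (adjoint A) \o modulus (adjoint A))
        + (numerical_radius B ^+ 2)%:C
          *: (modulus (adjoint B) \o modulus (adjoint B)))
     + 2 * numerical_radius A * numerical_radius B
         * numerical_radius (A \o adjoint B)).
Proof.
set F := (X in opnorm X).
have FE x : F x = (numerical_radius A ^+ 2)%:C *: adjoint (adjoint A) (adjoint A x)
                + (numerical_radius B ^+ 2)%:C *: adjoint (adjoint B) (adjoint B x).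
  by rewrite -(modulusP (adjoint A)).2 -(modulusP (adjoint B)).2.
have bnd (T : bounded_op H) : bounded_map T by exact: bop_bounded.
have bndM (S T : H -> H) : bounded_map S -> bounded_map T -> bounded_map (S \o T).
  move=> [M SM] [N TN]; exists (`|M| * N) => x /=; apply: le_trans (SM _) _.
  apply: le_trans (ler_wpM2r (hnorm_ge0 _) (ler_norm M)) _.
  by rewrite -mulrA ler_wpM2l.
have Fbnd : bounded_map F.
  have [M AM] := bndM _ _ (bnd (adjoint (adjoint A))) (bnd (adjoint A)).
  have [N BN] := bndM _ _ (bnd (adjoint (adjoint B))) (bnd (adjoint B)).
  exists (numerical_radius A ^+ 2 * M + numerical_radius B ^+ 2 * N) => x.
  rewrite FE mulrDl; apply: le_trans (ler_hnormD _ _) _.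
  by apply: lerD; rewrite hnormZ normc_real ?sqr_ge0// -[leRHS]mulrA
                          ler_wpM2l ?sqr_ge0// ?AM ?BN.
apply: sup_sqr_le; first exact: sqrtr_ge0.
move=> _ [x /= x1 <-]; split; first exact: sqrtr_ge0.
set p := dotp (A x) x; set q := dotp (B x) x.
set a := normc p; set b := normc q.
have a0 : 0 <= a by exact: normc_ge0.
have b0 : 0 <= b by exact: normc_ge0.
have aA : a <= numerical_radius A by exact: le_numerical_radius (bnd A) x1.
have bB : b <= numerical_radius B by exact: le_numerical_radius (bnd B) x1.
rewrite sqr_sqrtr ?addr_ge0 ?sqr_ge0//.
pose w := p *: adjoint A x + q *: adjoint B x.
have ab_w : a ^+ 2 + b ^+ 2 <= hnorm w.
  have -> : a ^+ 2 + b ^+ 2 = Re (dotp x w).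
    by rewrite dotpDr !dotpZr -!adjointP -/p -/q !conj_mul_normc.
  by apply: le_trans (cauchy_schwarz_Re _ _) _; rewrite x1 mul1r.
apply: le_trans ab_w _.
rewrite -[hnorm w]ger0_norm ?hnorm_ge0// -sqrtr_sqr ler_wsqrtr//.
rewrite hnormD_sqr !hnormZ !exprMn -/a -/b addrAC; apply: lerD; last first.
  rewrite -!mulrA ler_wpM2l//.
  apply: le_trans (Re_le_normc _) _.
  rewrite dotpZl dotpZr !Normc.normcM normc_conj -/a -/b.
  apply: ler_pM => //; first by rewrite mulr_ge0 ?normc_ge0.
  apply: ler_pM => //; first exact: normc_ge0.
  rewrite dotpC normc_conj -adjointP.
  exact: le_numerical_radius (bndM _ _ (bnd A) (bnd (adjoint B))) x1.
have x_le1 : hnorm x <= 1 by rewrite x1.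
apply: le_trans (le_opnorm Fbnd x_le1).
have := cauchy_schwarz_Re (F x) x; rewrite x1 mulr1; apply: le_trans.
rewrite FE dotpDl !dotpZl (dotp_adjointl (adjoint A)) (dotp_adjointl (adjoint B)).
rewrite !dotpxx -!rmorphM -rmorphD /=.
by apply: lerD; rewrite ler_wpM2r ?exprn_ge0 ?hnorm_ge0// ler_pXn2r ?nnegrE//
                        numerical_radius_ge0.
Qed.
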